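(* Let $k$ be a field, $n$ a positive integer and $\sigma, \tau \in \mathfrak{S}_n$. The permutation matrices $P_\sigma$ and $P_\tau$ are similar over $k$ if and only if $\sigma$ and $\tau$ are conjugate in $\mathfrak{S}_n$.
   Context: $\mathfrak{S}_n$ is the symmetric group of degree $n$. For $\sigma\in\mathfrak{S}_n$, $P_\sigma$ is the $n\times n$ matrix over $k$ whose $(i,j)$-entry is $\delta_{\sigma(i),j}$ (Kronecker delta). The field $k$ is arbitrary (any characteristic). *)

(* Defs.v *)
From mathcomp Require Import all_boot all_fingroup all_algebra.

Set Implicit Arguments.
Unset Strict Implicit.
Unset Printing Implicit Defensive.

Local Open Scope ring_scope.

(* The convention for [perm_mx]: row i has its 1 in column s i. *)
Fact perm_mx_entry (k : fieldType) (n : nat) (s : 'S_n) (i j : 'I_n) :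
  perm_mx s i j = (s i == j)%:R :> k.
Proof. by rewrite !mxE. Qed.

(* Main.v *)
(** Brauer's permutation lemma.  The fixed space of [perm_mx s] is spanned by
    the indicators of the cycles of [s], so over any field similarity of
    [perm_mx s] and [perm_mx t] forces [s ^+ m] and [t ^+ m] to have equally
    many cycles for every [m].  A cycle of length [l] splits into [gcdn l m]
    cycles in the [m]-th power, and the numbers [\sum_l gcdn l m] determine the
    multiset of lengths [l]: writing [gcdn l m] as the sum of [totient d] over
    the common divisors [d] makes the system triangular in the number of [l]
    divisible by [d].  Finally, permutations of the same cycle type are
    conjugate. *)
Require Import Defs.
From mathcomp Require Import all_boot all_fingroup all_algebra.
From mathcomp Require Import cyclic.

Import GRing.Theory Num.Theory.

(** * Recovering a list of positive integers from its gcd sums *)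

Lemma sum_totient_gcd (a m : nat) : (0 < m) ->
  (\sum_(d < m.+1 | d %| m) totient d * (d %| a) = gcdn a m).
Proof.
move=> m0; rewrite -[RHS]sum_totient_dvd.
have gm : ((gcdn a m).+1 <= m.+1) by rewrite ltnS dvdn_leq // dvdn_gcdr.
rewrite (big_ord_widen_cond _ (dvdn^~ (gcdn a m)) totient gm).
rewrite [RHS]big_mkcond [LHS]big_mkcond; apply: eq_bigr => d _ /=.
rewrite ltnS dvdn_gcd andbC.
case: (boolP (d %| m)) => dm; last by rewrite andbF andbF.
case: (boolP (d %| a)) => da; rewrite ?andbF ?muln0 // muln1 andbT dvdn_leq //.
  by rewrite gcdn_gt0 m0 orbT.
by rewrite dvdn_gcd da.
Qed.

Lemma sum_gcd_count_dvd (S : seq nat) (m : nat) : (0 < m) ->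
  (\sum_(a <- S) gcdn a m
   = \sum_(d < m.+1 | d %| m) totient d * count (dvdn d) S).
Proof.
move=> m0; under eq_bigr => a _ do rewrite -sum_totient_gcd //.
rewrite exchange_big; apply: eq_bigr => d _.
by rewrite -big_distrr /= -sumn_count sumnE big_map.
Qed.

Lemma eq_count_dvd (S T : seq nat) :
  (forall m, (0 < m) ->
    (\sum_(a <- S) gcdn a m = \sum_(a <- T) gcdn a m)) ->
  forall d, (0 < d) -> count (dvdn d) S = count (dvdn d) T.
Proof.
move=> eqST; elim/ltn_ind=> m IH m0.
have := eqST m m0; rewrite !sum_gcd_count_dvd //.
(* The term [d = m] is isolated. The other divisors are smaller, so their terms agree by induction,
   and [totient m] is nonzero. *)
rewrite (bigD1 ord_max) //= [in RHS](bigD1 ord_max) //=.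
rewrite (eq_bigr (fun d : 'I_m.+1 => totient d * count (dvdn d) T)).
  by move/addIn/eqP; rewrite eqn_pmul2l ?totient_gt0 // => /eqP.
move=> d /andP[dm dmax]; rewrite IH ?(dvdn_gt0 m0 dm) //.
by rewrite ltn_neqAle -ltnS ltn_ord andbT.
Qed.

(* The two lists have the same maximum, which can be removed from both. *)
Lemma perm_eq_count_dvd (S T : seq nat) :
  all (ltn 0) S -> all (ltn 0) T ->
  (forall d, (0 < d) -> count (dvdn d) S = count (dvdn d) T) ->
  perm_eq S T.
Proof.
elim: {S}(size S) {-2}S (erefl (size S)) T => [|n IH] S szS T S0 T0 eqST.
  have := eqST 1 isT; rewrite (eq_count dvd1n) (eq_count dvd1n) !count_predT.
  by rewrite szS => /esym/size0nil ->; rewrite (size0nil szS).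
have exS : exists i, i \in S.
  by case: S szS {S0 eqST} => // a S _; exists a; rewrite mem_head.
have ubS i : i \in S -> (i <= \max_(j <- S) j).
  by move=> iS; exact: (leq_bigmax_seq _ iS).
case: (ex_maxnP exS ubS) => M MS maxM.
have M0 : 0 < M by exact: (allP S0).
(* Counting multiples of [M], then of [b], gives [M %| b] and [b %| a] with [a] in [S]; maximality
   of [M] forces [b = M]. *)
have /hasP[b bT Mb] : has (dvdn M) T.
  rewrite has_count -eqST // -has_count.
  by apply/hasP; exists M.
have b0 : 0 < b by exact: (allP T0).
have /hasP[a aS ba] : has (dvdn b) S.
  by rewrite has_count eqST // -has_count; apply/hasP; exists b.
have bM : b = M.
  apply/eqP; rewrite eqn_leq (dvdn_leq b0 Mb) andbT.
  exact: leq_trans (dvdn_leq (allP S0 _ aS) ba) (maxM _ aS).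
move: bT; rewrite bM => MT.
have pS := perm_to_rem MS; have pT := perm_to_rem MT.
rewrite (perm_trans pS) // perm_sym (perm_trans pT) // perm_cons perm_sym.
apply: IH => [|||d d0].
- by rewrite size_rem // szS.
- by apply/allP=> x /mem_rem; apply/allP.
- by apply/allP=> x /mem_rem; apply/allP.
have /seq.permP/(_ (dvdn d)) := pS; have /seq.permP/(_ (dvdn d)) := pT.
by rewrite /= eqST // => -> /addnI.
Qed.

(** Used with cardinality for [f] and [g], to match the cycles of two permutations by length. The
    default [y0] only serves the empty list. *)
Lemma perm_eq_map_inj (T1 T2 T3 : eqType) (y0 : T2) (f : T1 -> T3)
    (g : T2 -> T3) (s : seq T1) (t : seq T2) :
  uniq s -> uniq t -> perm_eq (map f s) (map g t) ->
  exists phi : T1 -> T2, {in s &, injective phi} /\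
    {in s, forall x, phi x \in t /\ g (phi x) = f x}.
Proof.
elim: s t => [|x s IH] t /= us ut pst.
  by exists (fun=> y0); split=> // x.
case/andP: us => xs us.
have /mapP[y yt fxy] : f x \in map g t by rewrite -(perm_mem pst) mem_head.
have pt := perm_to_rem yt.
have [||phi [phiI phiP]] := IH (rem y t) us; first exact: rem_uniq.
  rewrite -(perm_cons (f x)) (perm_trans pst) // fxy.
  exact: (perm_map g pt).
have yphi z : z \in s -> phi z != y.
  by move=> /phiP[+ _]; rewrite mem_rem_uniq // inE => /andP[].
exists (fun z => if z == x then y else phi z); split.
  move=> z1 z2; rewrite !inE.
  have [-> _|z1x /= z1s] := eqVneq z1 x; have [-> //|z2x /= z2s] := eqVneq z2 x.
  - by move=> e; move: (yphi _ z2s); rewrite -e eqxx.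
  - by move=> _ e; move: (yphi _ z1s); rewrite e eqxx.
  - exact: phiI.
move=> z; rewrite inE; case: eqVneq => [-> //|_ /= /phiP[zt ->]].
by split=> //; exact: mem_rem zt.
Qed.

Local Open Scope ring_scope.

(** * Cycles of powers, and conjugacy from the cycle type *)

Section Cycles.

Variable T : finType.
Implicit Types (s t : {perm T}) (x y : T).

Lemma eq_expg_porbit s x (i j : nat) :
  ((s ^+ i)%g x == (s ^+ j)%g x) = (i == j %[mod #|porbit s x|]).
Proof.
set l := #|porbit s x|.
have l0 : (0 < l)%N by rewrite lt0n card_porbit_neq0.
have red k : (s ^+ k)%g x = nth x (traject s x l) (k %% l).
  rewrite nth_traject ?ltn_pmod // permX {1}(divn_eq k l) addnC iterD.
  congr iter; elim: (k %/ l)%N => // q IHq.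
  by rewrite mulSn iterD IHq iter_porbit.
by rewrite !red nth_uniq ?size_traject ?ltn_pmod // uniq_traject_porbit.
Qed.

(** With [l] the cycle length and [g = gcdn l m], the power [s ^+ (m * i)] fixes [x] iff [l] divides
    [m * i], that is, iff [l %/ g] divides [i], by Gauss. Both sides thus have the same
    multiples. *)
Lemma card_porbit_expg s x (m : nat) :
  #|porbit (s ^+ m)%g x| = (#|porbit s x| %/ gcdn #|porbit s x| m)%N.
Proof.
set l := #|porbit s x|.
have l0 : (0 < l)%N by rewrite lt0n card_porbit_neq0.
have g0 : (0 < gcdn l m)%N by rewrite gcdn_gt0 l0.
have dvdE i : (#|porbit (s ^+ m)%g x| %| i = (l %/ gcdn l m %| i))%N.
  have fixP t k : ((t ^+ k)%g x == x) = (#|porbit t x| %| k)%N.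
    by rewrite -{2}[x]perm1 -(expg0 t) eq_expg_porbit mod0n.
  rewrite -fixP -expgM fixP -/l -{1}(divnK (dvdn_gcdl l m)).
  rewrite -{3}(divnK (dvdn_gcdr l m)) mulnAC dvdn_pmul2r //.
  rewrite Gauss_dvdr // /coprime -(eqn_pmul2r g0) mul1n muln_gcdl.
  by rewrite !divnK ?dvdn_gcdl ?dvdn_gcdr.
by apply/eqP; rewrite eqn_dvd dvdE dvdnn -dvdE dvdnn.
Qed.

(* Each cycle is counted once by giving weight 1/l to each of its l points. *)
Lemma sum_porbits s (g : nat -> rat) :
  \sum_(A in porbits s) g #|A|
  = \sum_x g #|porbit s x| / #|porbit s x|%:R.
Proof.
rewrite (partition_big_imset (porbit s)) /=; apply: eq_bigr => A AP.
rewrite (eq_bigr (fun=> g #|A| / #|A|%:R)); last by move=> x /eqP ->.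
rewrite sumr_const -[RHS]mulr_natr; case/imsetP: AP => x _ ->.
rewrite (_ : #|_| = #|porbit s x|) ?divfK ?pnatr_eq0 ?card_porbit_neq0 //.
by apply: eq_card => y; rewrite -eq_porbit_mem.
Qed.

(** Summed over points, both sides agree termwise: a point on a cycle of length [l] contributes
    [gcdn l m / l], the inverse length of its cycle under [s ^+ m]. *)
Lemma card_porbits_expg s (m : nat) :
  #|porbits (s ^+ m)%g| = (\sum_(A in porbits s) gcdn #|A| m)%N.
Proof.
apply/eqP; rewrite -(eqr_nat rat) natr_sum.
rewrite (sum_porbits s (fun l => (gcdn l m)%:R)) -sum1_card natr_sum.
rewrite (sum_porbits (s ^+ m)%g (fun=> 1)).
apply/eqP/eq_bigr => x _; rewrite card_porbit_expg.
set l := #|porbit s x|.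
have l0 : (0 < l)%N by rewrite lt0n card_porbit_neq0.
have g0 : (0 < gcdn l m)%N by rewrite gcdn_gt0 l0.
have lg0 : (0 < l %/ gcdn l m)%N by rewrite divn_gt0 // dvdn_leq // dvdn_gcdl.
rewrite -{4}(divnK (dvdn_gcdl l m)) natrM invfM mulrCA divff ?mulr1 ?mul1r //.
by rewrite pnatr_eq0 -lt0n.
Qed.

Definition cycle_type s : seq nat :=
  [seq #|A| | A : {set T} <- enum (porbits s)].

Lemma sum_gcd_cycle_type s (m : nat) :
  (\sum_(a <- cycle_type s) gcdn a m)%N = #|porbits (s ^+ m)%g|.
Proof. by rewrite big_map big_enum card_porbits_expg. Qed.

Lemma cycle_type_gt0 s : all (ltn 0) (cycle_type s).
Proof.
apply/allP=> _ /mapP[A + ->]; rewrite mem_enum => /imsetP[x _ ->].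
by rewrite /= lt0n card_porbit_neq0.
Qed.

Lemma cycle_type_eq_card_porbits s t :
  (forall m, #|porbits (s ^+ m)%g| = #|porbits (t ^+ m)%g|) ->
  perm_eq (cycle_type s) (cycle_type t).
Proof.
move=> est; apply: perm_eq_count_dvd; try exact: cycle_type_gt0.
by apply: eq_count_dvd => m _; rewrite !sum_gcd_cycle_type.
Qed.

(** Match cycles of equal length by [phi] and fix a root in each cycle; the conjugator sends the
    [i]-th iterate of a root under [s] to the [i]-th iterate under [t] of the root of the matched
    cycle. *)
Lemma conjugate_of_cycle_type s t :
  perm_eq (cycle_type s) (cycle_type t) -> exists r, t = (s ^ r)%g.
Proof.
case/(perm_eq_map_inj _ _ _ set0 _ _ _ _ (enum_uniq _) (enum_uniq _)).
move=> phi [phiI phiP].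
have sP x : porbit s x \in enum (porbits s) by rewrite mem_enum imset_f.
(* The default [x] matters only for empty [A], so on cycles the root is independent of it. *)
pose root x (A : {set T}) := odflt x [pick y in A].
have rootP u y (A : {set T}) x : A = porbit u y -> porbit u (root x A) = A.
  move=> ->; rewrite /root; case: pickP => [z zy|/(_ y)]; last first.
    by rewrite porbit_id.
  by apply/eqP; rewrite eq_porbit_mem.
have rootE u y (A : {set T}) x x' : A = porbit u y -> root x A = root x' A.
  move=> ->; rewrite /root; case: pickP => // /(_ y).
  by rewrite porbit_id.
have phi_porbit x : exists y, phi (porbit s x) = porbit t y.
  have [+ _] := phiP _ (sP x); rewrite mem_enum => /imsetP[y _ ->].
  by exists y.
pose idx x := index x (traject s (root x (porbit s x)) #|porbit s x|).
have idxP x : (s ^+ idx x)%g (root x (porbit s x)) = x.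
  set y := root x (porbit s x).
  have ys : porbit s y = porbit s x by exact: rootP.
  have xin : x \in traject s y #|porbit s x|.
    by rewrite -ys -porbit_traject ys porbit_id.
  have idx_lt : (idx x < #|porbit s x|)%N.
    by rewrite -index_mem size_traject in xin.
  rewrite permX -(nth_traject s idx_lt).
  exact: nth_index xin.
pose rho x := (t ^+ idx x)%g (root x (phi (porbit s x))).
(* Matched cycles have equal length, so both equalities are the same congruence on [i] and [j]. This
   yields injectivity and equivariance of [rho]. *)
have modE x i j : (s ^+ i)%g (root x (porbit s x)) =
    (s ^+ j)%g (root x (porbit s x)) <->
    (t ^+ i)%g (root x (phi (porbit s x))) =
    (t ^+ j)%g (root x (phi (porbit s x))).
  have [y tE] := phi_porbit x; have [_ cE] := phiP _ (sP x).
  have e : #|porbit s (root x (porbit s x))| =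
      #|porbit t (root x (phi (porbit s x)))|.
    by rewrite (rootP s x) // (rootP t y) // cE.
  by split=> /eqP; rewrite eq_expg_porbit => h; apply/eqP;
    rewrite eq_expg_porbit ?e // -e.
have porbit_rho x : porbit t (rho x) = phi (porbit s x).
  by have [y tE] := phi_porbit x; rewrite /rho porbit_perm (rootP t y).
have root_phi x y z : root y (phi (porbit s x)) = root z (phi (porbit s x)).
  by have [w tE] := phi_porbit x; exact: (rootE t w).
have rho_inj : injective rho.
  move=> x y exy.
  have eO : porbit s x = porbit s y.
    by apply: phiI; rewrite ?sP // -!porbit_rho exy.
  move: exy; rewrite /rho -eO (root_phi x y x) => exy.
  rewrite -(idxP x) -(idxP y) -eO (rootE s x _ y x) //.
  exact/modE.
have rhoS x : rho (s x) = t (rho x).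
  have eO : porbit s (s x) = porbit s x by rewrite (porbit_perm s 1 x).
  rewrite /rho -permM -expgSr eO (root_phi x (s x) x); apply/modE.
  rewrite expgSr permM idxP (rootE s x _ x (s x)) // -[in LHS]eO.
  exact: idxP.
exists (perm rho_inj); apply/permP=> y.
by rewrite -[y](permKV (perm rho_inj)) permJ !permE rhoS.
Qed.

End Cycles.

(** * The fixed space of a permutation matrix *)

Section FixedSpace.

Variables (k : fieldType) (n : nat).
Implicit Types (s t : 'S_n).

Lemma mulmx_perm_mxE m (A : 'M[k]_(m, n)) s i j :
  (A *m perm_mx s) i j = A i ((s^-1)%g j).
Proof. by rewrite -{1}[s]invgK -col_permE mxE. Qed.

Lemma rank_fixed_perm_mx s :
  \rank (kermx (perm_mx s - 1%:M : 'M[k]_n)) = #|porbits s|.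
Proof.
have cyc (a : 'I_#|porbits s|) : exists x, enum_val a == porbit s x.
  by have /imsetP[x _ ->] := enum_valP a; exists x.
pose root a := xchoose (cyc a).
have rootP a : enum_val a = porbit s (root a).
  exact/eqP/(xchooseP (cyc a)).
(* The rows of [B] are the cycle indicators, and [C] evaluates a row at one point per cycle.
   Independence is [B *m C = 1%:M]; spanning is [u = u *m C *m B] for fixed [u]. *)
pose B : 'M[k]_(#|porbits s|, n)
  := \matrix_(a, j) (j \in (enum_val a : {set 'I_n}))%:R.
pose C : 'M[k]_(n, #|porbits s|) := \matrix_(j, a) (j == root a)%:R.
have BC : B *m C = 1%:M.
  apply/matrixP=> a b; rewrite !mxE (bigD1 (root b)) //= big1 => [|j jb].
    rewrite !mxE eqxx mulr1 addr0 -(inj_eq enum_val_inj) [enum_val b]rootP.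
    by rewrite rootP -eq_porbit_mem eq_sym.
  by rewrite !mxE (negbTE jb) mulr0.
have Bfree : row_free B by apply/row_freeP; exists C.
rewrite -(eqP Bfree); apply: eqmx_rank; apply/andP; split; last first.
  rewrite sub_kermx mulmxBr mulmx1 subr_eq0; apply/eqP/matrixP=> a j.
  rewrite mulmx_perm_mxE !mxE; congr ((_ : bool)%:R).
  by rewrite rootP -!eq_porbit_mem -(porbit_perm s 1 (_ j)) permKV.
set u := kermx _; have : u *m (perm_mx s - 1%:M) = 0 by exact: mulmx_ker.
move: u => u /eqP; rewrite mulmxBr mulmx1 subr_eq0 => /eqP us.
(* Fixed rows are constant along cycles. *)
have usi i j m : u i ((s ^+ m)%g j) = u i j.
  elim: m => [|m IH]; first by rewrite perm1.
  by rewrite -IH expgSr permM -[in LHS]us mulmx_perm_mxE permK.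
apply/submxP; exists (u *m C); apply/matrixP=> i j.
have jP : porbit s j \in porbits s by rewrite imset_f.
pose a := enum_rank_in jP (porbit s j).
have aE : enum_val a = porbit s j by rewrite enum_rankK_in.
rewrite [RHS]mxE (bigD1 a) //= big1 => [|b ba].
  rewrite addr0 [B a j]mxE aE porbit_id mulr1 mxE (bigD1 (root a)) //= big1.
    rewrite addr0 [C _ _]mxE eqxx mulr1.
    have /porbitP[m ->] : root a \in porbit s j.
      by rewrite -aE rootP porbit_id.
    by rewrite usi.
  by move=> x xa; rewrite [C _ _]mxE (negbTE xa) mulr0.
rewrite [B b j]mxE rootP -eq_porbit_mem -rootP -aE (inj_eq enum_val_inj).
by rewrite eq_sym (negbTE ba) mulr0.
Qed.

(** [V] also intertwines the matrices minus the identity, so these have equal rank and hence equal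
    nullity. *)
Lemma card_porbits_similar s t (V : 'M[k]_n) : V \in unitmx ->
  V *m perm_mx s = perm_mx t *m V -> #|porbits s| = #|porbits t|.
Proof.
move=> Vu VsV; rewrite -!rank_fixed_perm_mx !mxrank_ker; congr (_ - _)%N.
have Vfull : row_full V by rewrite row_full_unit.
have Vfree : row_free V by rewrite row_free_unit.
rewrite -(eqmxMfull (perm_mx s - 1%:M) Vfull) mulmxBr VsV mulmx1.
by rewrite -{2}[V]mul1mx -mulmxBl mxrankMfree.
Qed.

Lemma perm_mx_expg_intertwine s t (V : 'M[k]_n) (m : nat) :
  V *m perm_mx s = perm_mx t *m V ->
  V *m perm_mx (s ^+ m)%g = perm_mx (t ^+ m)%g *m V.
Proof.
move=> VsV; elim: m => [|m IH]; first by rewrite !perm_mx1 mulmx1 mul1mx.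
by rewrite !expgS !perm_mxM mulmxA VsV -mulmxA IH mulmxA.
Qed.

End FixedSpace.

Theorem theoremA1 (k : fieldType) (n : nat) (hn : (0 < n)%N) (sigma tau : 'S_n) :
  (perm_mx sigma : 'M[k]_n) ~_{in unitmx} (perm_mx tau : 'M[k]_n) <->
  (exists rho : 'S_n, tau = (sigma ^ rho)%g).
Proof.
split=> [[V Vu /(simmxP Vu) VsV] | [rho ->]].
  apply: conjugate_of_cycle_type; apply: cycle_type_eq_card_porbits => m.
  apply: (card_porbits_similar _ _ _ _ _ Vu).
  exact: perm_mx_expg_intertwine.
(* [perm_mx] is multiplicative, and [rho^-1 * sigma] equals [sigma ^ rho * rho^-1]. *)
exists (perm_mx rho^-1); first exact: unitmx_perm.
apply/simmxP; first exact: unitmx_perm.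
by rewrite -!perm_mxM conjgE -!mulgA mulgV mulg1.
Qed.
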